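(* The set $U(T,E)\cup\{0\}$ contains an $\mathbb{F}$-vector subspace of $H(T,E)$ that is dense in $H(T,E)$. (Here $U(T,E)$ is the set of universal generalized harmonic functions.)
   Context: Tree. $T=\bigcup_{n=0}^\infty T_n$ is the vertex set of a rooted tree; $T_n$ is the (finite) set of vertices at level $n$, the $T_n$ are pairwise disjoint, $T_0=\{x_0\}$. Every $x\in T_n$ has a set of children $S(x)\subset T_{n+1}$ with at least two elements, and $(S(x))_{x\in T_n}$ is a partition of $T_{n+1}$. Field and vector space. $\mathbb{F}$ is a field with a separable Hausdorff topology for which addition and the inverse function are continuous. $E$ is a separable topological vector space over $\mathbb{F}$ whose topology is induced by a translation invariant metric $d$; $(E,d)$ is not assumed complete. Generalized harmonic functions. For every $x\in T$ and $y\in S(x)$ an element $w(x,y)\in\mathbb{F}\setminus\{0\}$ is fixed. $H(T,E)$ is the set of functions $f:T\to E$ with $f(x)=\sum_{y\in S(x)}w(x,y)f(y)$ for all $x\in T$. It carries the subspace topology from $E^T$ with the product topology (induced by the metric $\rho(f,g)=\sum_{n=0}^\infty 2^{-n}\frac{d(f(x_n),g(x_n))}{1+d(f(x_n),g(x_n))}$, where $(x_n)_{n\ge 0}$ is a fixed enumeration of $T$). Boundary and measure. Real weights $q(x,y)\ge 0$ ($x,y\in T$) are given with $q(x,y)>0$ if and only if $y\in S(x)$, and $\sum_{y\in S(x)}q(x,y)=1$ for all $x$. The boundary $\partial T$ is the set of all infinite geodesics $e=\{z_n:n\ge 0\}$ with $z_0=x_0$ and $z_{n+1}\in S(z_n)$.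 For $x\in T$, $B_x=\{e\in\partial T: x\in e\}$. $M_n$ is the $\sigma$-algebra on $\partial T$ generated by $\{B_x\}_{x\in T_n}$, and $M$ is the $\sigma$-algebra generated by $\bigcup_n M_n$. $\mathbb{P}$ is the unique probability measure on $M$ such that for $x\in T_n$, $\mathbb{P}(B_x)=\prod_{j=0}^{n-1}q(y_j,y_{j+1})$, where $x_0=y_0,y_1,\dots,y_n=x$ is the unique path from the root to $x$. $L^0(\partial T,E)$ is the space of $M$-measurable functions $h:\partial T\to E$ (that is, $h^{-1}(V)\in M$ for every open $V\subset E$), modulo $\mathbb{P}$-a.e. equality, with the topology of convergence in probability, given by the metric $d_{\mathbb{P}}(h,g)=\int_{\partial T}\frac{d(h(e),g(e))}{1+d(h(e),g(e))}\,d\mathbb{P}(e)$. For $f:T\to E$ and $n\ge 0$, $\omega_n(f):\partial T\to E$ is defined by $\omega_n(f)(e)=f(z)$, where $z$ is the unique element of $e\cap T_n$. Universality. $f\in H(T,E)$ is universal, written $f\in U(T,E)$, if the sequence $\omega_n(f)$, $n=0,1,2,\dots$, is dense in $L^0(\partial T,E)$. *)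

(* Defs.v *)
From HB Require Import structures.
From mathcomp Require Import all_boot all_order all_algebra finmap.
From mathcomp Require Import generic_quotient.
From mathcomp Require Import all_classical all_reals all_analysis.

Set Implicit Arguments.
Unset Strict Implicit.
Unset Printing Implicit Defensive.

Import Order.TTheory GRing.Theory Num.Theory.

Local Open Scope classical_set_scope.
Local Open Scope ring_scope.

Definition separable (X : topologicalType) :=
  exists2 D : set X, countable D & dense D.

(* A field carrying a topology; no compatibility is built in. *)
#[short(type="fieldTopologicalType")]
HB.structure Definition FieldTopological :=
  {F of GRing.Field F & Topological F}.

(* Multiplication is not required to be continuous; inversion is considered on
   the nonzero elements. *)
Record admissible_scalars (F : fieldTopologicalType) : Prop := {
  scalars_hausdorff : hausdorff_space F;
  scalars_separable : separable F;
  scalars_add_continuous : continuous (fun z : F * F => z.1 + z.2);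
  scalars_inv_continuous :
    {within [set x : F | x != 0], continuous (@GRing.inv F)} }.

Record invariant_metric (R : realType) (E : zmodType) := InvariantMetric {
  dist :> E -> E -> R;
  distxx : forall x, dist x x = 0;
  dist_positivity : forall x y, dist x y = 0 -> x = y;
  dist_sym : forall x y, dist x y = dist y x;
  dist_triangle : forall y x z, dist x z <= dist x y + dist y z;
  dist_translation : forall z x y, dist (x + z) (y + z) = dist x y }.

(* The topologies of the library's modules are tied to scalars in a
   numDomainType, hence the topology of a module over an arbitrary field is
   carried by an alias of its carrier. *)
Definition metric_space (R : realType) (E : zmodType)
  (d : invariant_metric R E) : Type := E.

HB.instance Definition _ R E (d : invariant_metric R E) :=
  Choice.on (metric_space d).
HB.instance Definition _ R E (d : invariant_metric R E) :=
  isMetric.Build R (metric_space d)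
    (distxx d) (@dist_positivity _ _ d) (dist_sym d) (dist_triangle d).
HB.instance Definition _ R E (d : invariant_metric R E) :=
  isPointed.Build (metric_space d) (0 : E).

Record separable_tvs (R : realType) (F : fieldTopologicalType) (E : lmodType F)
    (d : invariant_metric R E) : Prop := {
  tvs_add_continuous : continuous
    (fun z : metric_space d * metric_space d =>
       ((z.1 : E) + (z.2 : E) : metric_space d));
  tvs_scale_continuous : continuous
    (fun z : F * metric_space d => (z.1 *: (z.2 : E) : metric_space d));
  tvs_separable : separable (metric_space d) }.

Definition borel (R : realType) (E : zmodType) (d : invariant_metric R E) :=
  g_sigma_algebraType (open : set (set (metric_space d))).
HB.instance Definition _ R E (d : invariant_metric R E) :=
  Measurable.on (borel d).

Record rooted_tree (T : choiceType) := RootedTree {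
  level : nat -> {fset T};
  tree_root : T;
  children : T -> {fset T};
  level_cover : forall x, exists n, x \in level n;
  level_disjoint : forall m n, m != n -> [disjoint level m & level n]%fset;
  level0 : level 0 = [fset tree_root]%fset;
  children_ge2 : forall x, (2 <= #|` children x|)%N;
  children_level : forall n x, x \in level n ->
    (children x `<=` level n.+1)%fset;
  children_disjoint : forall n x y, x \in level n -> y \in level n ->
    x != y -> [disjoint children x & children y]%fset;
  children_cover : forall n y, y \in level n.+1 ->
    exists2 x, x \in level n & y \in children x }.

Section Harmonic.
Context (T : choiceType) (t : rooted_tree T).
Context (F : fieldType) (E : lmodType F) (w : T -> T -> F).

Definition harmonic_functions : set (T -> E) :=
  [set f | forall x, f x = \sum_(y <- children t x) w x y *: f y].

End Harmonic.

(* A geodesic from the root, encoded by its sequence of vertices; see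
   [ray_levelP] for its intersection with the levels. *)
Record rays (T : choiceType) (t : rooted_tree T) := Ray {
  ray_vertex :> nat -> T;
  ray0 : ray_vertex 0%N = tree_root t;
  rayS : forall n, ray_vertex n.+1 \in children t (ray_vertex n) }.

Section Rays.
Context (T : choiceType) (t : rooted_tree T).

HB.instance Definition _ := gen_eqMixin (rays t).
HB.instance Definition _ := gen_choiceMixin (rays t).

Let first_child x := head x (enum_fset (children t x)).

Let first_childP x : first_child x \in children t x.
Proof.
suff: forall s : seq T, (2 <= size s)%N -> head x s \in s.
  by apply; exact: children_ge2.
by case=> // y s _; rewrite mem_head.
Qed.

Let point_ray : rays t.
Proof.
by exists (fun n => iter n first_child (tree_root t)) => // n; exact: first_childP.
Defined.

HB.instance Definition _ := isPointed.Build (rays t) point_ray.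

Definition rays_through (x : T) : set (rays t) := [set e | exists n, e n = x].

Lemma ray_level (e : rays t) n : e n \in level t n.
Proof.
elim: n => [|n IHn]; first by rewrite ray0 level0 inE.
exact: (fsubsetP (children_level IHn)) (rayS e n).
Qed.

Lemma ray_levelP (e : rays t) n x :
  (rays_through x e /\ x \in level t n) <-> x = e n.
Proof.
split=> [[[m <-] emn]|->]; last by split; [exists n|exact: ray_level].
case: (eqVneq m n) => [->//|/(level_disjoint t)/fdisjointP/(_ _ (ray_level e m))].
by rewrite emn.
Qed.

Definition level_events (n : nat) : set (set (rays t)) :=
  <<s [set rays_through x | x in [set` level t n]] >>.

Definition boundary := g_sigma_algebraType (\bigcup_n level_events n).
HB.instance Definition _ := Measurable.on boundary.

Lemma measurable_rays_through x : measurable (rays_through x : set boundary).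
Proof.
have [n xn] := level_cover t x.
apply: sub_sigma_algebra; exists n => //.
by apply: sub_sigma_algebra; exists x.
Qed.

End Rays.

Section Transition.
Context (R : realType) (T : choiceType) (t : rooted_tree T).

Record transition (q : T -> T -> R) : Prop := {
  transition_ge0 : forall x y, 0 <= q x y;
  transition_gt0 : forall x y, 0 < q x y <-> y \in children t x;
  transition_sum : forall x, \sum_(y <- children t x) q x y = 1 }.

Definition boundary_law (q : T -> T -> R) (P : probability (boundary t) R) :=
  forall n x (y : nat -> T), x \in level t n ->
    y 0%N = tree_root t -> (forall j, (j < n)%N -> y j.+1 \in children t (y j)) ->
    y n = x ->
    P (rays_through x) = (\prod_(j < n) q (y j) (y j.+1))%:E.

End Transition.

Section L0.
Context (R : realType) (E : zmodType) (d : invariant_metric R E).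
Context (T : choiceType) (t : rooted_tree T).

Lemma measurable_fun_borelP (h : boundary t -> borel d) :
  measurable_fun setT h <->
  forall V : set (metric_space d), open V -> measurable (h @^-1` V).
Proof.
split=> [mh V oV|mh].
  by rewrite -[_ @^-1` _]setTI; apply: mh => //; exact: sub_sigma_algebra.
apply: (@measurability _ _ _ _ setT h (open : set (set (metric_space d)))) => //.
by move=> _ [V oV <-]; rewrite setTI; exact: mh.
Qed.

Definition omega (n : nat) (f : T -> E) : boundary t -> borel d :=
  fun e => f (e n).

Lemma measurable_omega n f : measurable_fun setT (omega n f).
Proof.
move=> _ B _; rewrite setTI.
rewrite (_ : _ @^-1` _ = \bigcup_(x in [set` level t n] `&` (f @^-1` B))
    (rays_through x : set (boundary t))).
  apply: fin_bigcup_measurable; first exact/finite_setIl/finite_fset.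
  by move=> x _; exact: measurable_rays_through.
apply/seteqP; split=> [e Bfe|e [x [xn Bfx]] xe].
  by exists (e n); [split => //=; exact: ray_level|exists n].
by have ex : x = (e : rays t) n by [apply/(ray_levelP e n x)];
  rewrite /preimage/= /omega -ex.
Qed.

HB.instance Definition _ n f :=
  isMeasurableFun.Build _ _ (boundary t) (borel d) (omega n f)
    (measurable_omega n f).

Context (P : probability (boundary t) R).

Definition L0 : Type := {mfun_ P, boundary t >-> borel d}.

HB.instance Definition _ := Choice.on L0.

Definition L0_fun (h : L0) : boundary t -> E := aqEqMfun_to_fun h.
Coercion L0_fun : L0 >-> Funclass.

Definition L0_dist (h g : L0) : \bar R :=
  (\int[P]_e (d (h e) (g e) / (1 + d (h e) (g e)))%:E)%E.

(* The topology given by the metric [L0_dist], that is, convergence in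
   probability; the integrand of [L0_dist] is measurable when E is separable. *)
Definition L0_open (U : set L0) :=
  forall h, U h -> exists2 eps : R, 0 < eps &
    [set g | (L0_dist h g < eps%:E)%E] `<=` U.

Let L0_openT : L0_open setT.
Proof. by move=> h _; exists 1. Qed.

Let L0_openI : setI_closed L0_open.
Proof.
move=> A B oA oB h [/oA[a a0 hA] /oB[b b0 hB]].
exists (Num.min a b) => [|g /=]; first by rewrite lt_min a0.
by rewrite EFin_min lt_min => /andP[ga gb]; split; [exact: hA|exact: hB].
Qed.

Let L0_open_bigU (I : Type) (f : I -> set L0) :
  (forall i, L0_open (f i)) -> L0_open (\bigcup_i f i).
Proof.
move=> of_ h [i _ /of_[e e0 hf]].
by exists e => // g /hf; exists i.
Qed.

HB.instance Definition _ :=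
  isOpenTopological.Build L0 L0_openT L0_openI L0_open_bigU.

Lemma L0_openE : (open : set (set L0)) = L0_open.
Proof. by []. Qed.

Definition omega_class (n : nat) (f : T -> E) : L0 :=
  (\pi_L0 (omega n f : {mfun boundary t >-> borel d}))%qT.

End L0.

Definition universal (R : realType) (T : choiceType) (t : rooted_tree T)
    (F : fieldType) (E : lmodType F) (d : invariant_metric R E)
    (w : T -> T -> F) (P : probability (boundary t) R) : set (T -> E) :=
  [set f | harmonic_functions t w f /\
           dense (range (fun n => omega_class d P n f))].

(* Main.v *)
Require Import Defs.
From HB Require Import structures.
From mathcomp Require Import all_boot all_order all_algebra finmap.
From mathcomp Require Import all_classical all_reals all_analysis.
From mathcomp Require Import measurable_realfun zify lra.

(** The space sought is the span of one sequence [f 0, f 1, ...] of harmonic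
functions, built level by level without any completeness or category argument.

A harmonic function can be modified beyond a level [N] so as to take prescribed
values at a deeper level [m], except on few rays.  The prescribed values on
level [m] extend harmonically upwards by the mean value relation, but the
extension then differs on level [N] from the function already constructed.  This
difference is cancelled by sending it, at each vertex, to a single child [b x],
chosen of transition probability at most [1/2]; it is carried by the
descending [b]-paths, whose mass at level [m] is at most [2^-(m - N)]
([retarget], [prob_along]).  The exceptional rays do not depend on the functions
involved, so the whole sequence can be modified at the same time
([interpolation]).

Fix a dense sequence [p] of [E].  Step [k] carries a task: an index [i], a level
[N] and a code of a function [c] on level [N] with values among the [p m].  At
level [(k + 1) ^ 2], off a set of mass at most [2^-(2 * k + 1)], the function
[f i] is made equal to [c] read at the ancestor of level [N], and every [f j]
with [j <= k], [j != i], is made equal to [0].  Each task recurs infinitely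
often.

If [u] is a combination of the [f j] with a nonzero coefficient [a i], then at
these steps [u] equals [a i *: c] off small sets.  Functions [a i *: c] are
dense in [L0]: the sequence [a i *: p m] is dense because scaling by [a i] is
invertible and continuous, so the sets where a measurable [h] is close to the
[m]-th term cover the boundary, and a suitable index [m] can be selected, up to
small probability, from one vertex of the ray ([level_selection]).  Hence [u] is
universal ([combination_dense]).

Finally [f j] is left equal to a prescribed harmonic function up to level
[j ^ 2].  Prescribing, each infinitely often, the harmonic extensions of the
countably many coded functions makes the [f j] themselves dense
([harmonic_approximation]). *)

Set Implicit Arguments.
Unset Strict Implicit.
Unset Printing Implicit Defensive.

Import Order.TTheory GRing.Theory Num.Theory.

Local Open Scope classical_set_scope.
Local Open Scope ring_scope.

(** * Levels and ancestors *)

Section Genealogy.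
Context (T : choiceType) (t : rooted_tree T).

Definition lev (x : T) : nat := xchoose (level_cover t x).

Lemma lev_level x : x \in level t (lev x).
Proof. exact: xchooseP (level_cover t x). Qed.

Lemma level_lev n x : x \in level t n -> lev x = n.
Proof.
move=> xn; apply/eqP/contraT => /(level_disjoint t)/fdisjointP.
by move=> /(_ _ (lev_level x)); rewrite xn.
Qed.

Lemma lev_child x y : y \in children t x -> lev y = (lev x).+1.
Proof.
by move=> yx; apply: level_lev; exact: fsubsetP (children_level (lev_level x)) _ yx.
Qed.

(** The default value [y] concerns the root alone. *)
Definition parent (y : T) : T := xget y [set x | y \in children t x].

Lemma parent_child x y : y \in children t x -> parent y = x.
Proof.
move=> yx; have yp : y \in children t (parent y).
  by rewrite /parent; case: xgetP => [z _ //|/(_ x)/(_ yx)].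
apply/eqP/contraT => pNx; have levp : parent y \in level t (lev x).
  have [<-] : (lev (parent y)).+1 = (lev x).+1 by rewrite -!(@lev_child _ y).
  exact: lev_level.
have /fdisjointP/(_ _ yp) := children_disjoint levp (lev_level x) pNx.
by rewrite yx.
Qed.

Lemma lev_ray (e : rays t) n : lev (e n) = n.
Proof. exact/level_lev/ray_level. Qed.

Lemma iter_parent_ray (e : rays t) n m : (n <= m)%N ->
  iter (m - n) parent (e m) = e n.
Proof.
move=> /subnK <-; rewrite addnK; elim: (m - n)%N => // k IHk.
by rewrite iterSr addSn (parent_child (rayS e _)).
Qed.

Lemma parent_mem n x : x \in level t n.+1 ->
  parent x \in level t n /\ x \in children t (parent x).
Proof. by move=> /children_cover[y yn xy]; rewrite (parent_child xy). Qed.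

Lemma root_path n x : x \in level t n -> exists y : nat -> T,
  [/\ y 0%N = tree_root t,
      forall j, (j < n)%N -> y j.+1 \in children t (y j) & y n = x].
Proof.
elim: n x => [x|n IHn x /parent_mem[/IHn[y [y0 yS yn]] xp]].
  by rewrite level0 inE => /eqP ->; exists (fun=> tree_root t).
exists (fun j => if (j <= n)%N then y j else x); split=> //.
  move=> j; rewrite ltnS => jn; rewrite jn; case: ltnP => [/yS//|nj].
  by have -> : j = n by [apply/eqP; rewrite eqn_leq jn]; rewrite yn.
by rewrite ltnn.
Qed.

End Genealogy.

(** * Modifying harmonic functions *)

Section HarmonicExtension.
Context (T : choiceType) (t : rooted_tree T).
Context (F : fieldType) (E : lmodType F) (w : T -> T -> F).
Hypothesis w_neq0 : forall x y, y \in children t x -> w x y != 0.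
Context (b : T -> T).
Hypothesis b_child : forall x, b x \in children t x.

Local Notation lev := (lev t).
Local Notation parent := (parent t).
Local Notation harmonic := (harmonic_functions t w).

Implicit Types (f v : T -> E) (x y : T).

(** Transports [v], read [k] levels above [y], along the distinguished children:
    a value at [x] goes entirely to [b x], divided by [w x (b x)], and the other
    children receive [0].  Harmonicity at [x] then holds by construction. *)
Fixpoint descend v k y : E :=
  if k is k'.+1 then
    if y == b (parent y) then (w (parent y) y)^-1 *: descend v k' (parent y)
    else 0
  else v y.

Definition push N v y := if (lev y < N)%N then 0 else descend v (lev y - N) y.

Lemma push_eq N v y : lev y = N -> push N v y = v y.
Proof. by move=> <-; rewrite /push ltnn subnn. Qed.

Lemma push_child N v x y : (N <= lev x)%N -> y \in children t x ->
  push N v y = if y == b x then (w x y)^-1 *: push N v x else 0.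
Proof.
move=> Nx yx; rewrite /push (lev_child yx) ltnNge leqW//= ltnNge Nx/=.
by rewrite subSn//= (parent_child yx).
Qed.

Lemma push_harmonic N v x : (N <= lev x)%N ->
  push N v x = \sum_(y <- children t x) w x y *: push N v y.
Proof.
move=> Nx; rewrite (bigD1_seq (b x)) ?b_child ?fset_uniq//=.
rewrite (push_child _ Nx (b_child x)) eqxx scalerA divff ?w_neq0// scale1r.
rewrite big_seq_cond big1 ?addr0// => y /andP[yx ynb].
by rewrite (push_child _ Nx yx) (negbTE ynb) scaler0.
Qed.

Definition along N m : set (rays t) :=
  [set e | forall n, (N <= n < m)%N -> e n.+1 = b (e n)].

(** A pushed function lives on the descending [b]-paths only, so any ray that
    leaves its [b]-path between level [N] and level [m] sees the value [0] there. *)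
Lemma push_off N m v (e : rays t) : (N <= m)%N -> ~ along N m e ->
  push N v (e m) = 0.
Proof.
elim: m => [|m IHm].
  by rewrite leqn0 => /eqP -> ; case=> n; rewrite ltn0 andbF.
rewrite leq_eqVlt => /predU1P[->|Nm].
  by case=> n /andP[]; rewrite ltnS => mn nm; have := leq_trans mn nm; rewrite ltnn.
move=> off; rewrite (@push_child _ _ (e m)) ?lev_ray//; last exact: rayS.
case: eqP => // eb; rewrite IHm ?scaler0// => on; apply: off => n /andP[Nn].
by rewrite ltnS leq_eqVlt => /predU1P[->//|nm]; apply: on; rewrite Nn.
Qed.

(** The mean value relation iterated [k] times: the value at [x] that a harmonic
    function must have if it equals [v] on the [k]-th generation below [x]. *)
Fixpoint average v k x : E :=
  if k is k'.+1 then \sum_(y <- children t x) w x y *: average v k' y else v x.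

(** Every function on level [m] extends to a harmonic function: the levels above
    are forced by the mean value relation, those below are free and are filled
    by pushing. *)
Definition extend m v y :=
  if (lev y <= m)%N then average v (m - lev y) y else push m v y.

Lemma extend_eq m v y : lev y = m -> extend m v y = v y.
Proof. by move=> <-; rewrite /extend leqnn subnn. Qed.

Lemma extend_harmonic m v : harmonic (extend m v).
Proof.
move=> x; rewrite /= {1}/extend; case: ltngtP => [xm|mx|xm].
- rewrite -[in LHS](@subnSK (lev x) m)//= !big_seq; apply: eq_bigr => y yx.
  by rewrite /extend (lev_child yx) xm.
- rewrite (push_harmonic v (ltnW mx)) !big_seq; apply: eq_bigr => y yx.
  by rewrite /extend (lev_child yx) leqNgt ltnS (ltnW mx).
- rewrite xm subnn/= -(push_eq v xm) push_harmonic ?xm// !big_seq.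
  by apply: eq_bigr => y yx; rewrite /extend (lev_child yx) xm ltnn.
Qed.

(** Changes the harmonic function [f] beyond level [N] only, so that it reaches
    the values [v] at level [m] on most rays.  The harmonic extension of [v]
    would reach them everywhere, but disagrees with [f] on level [N]; pushing
    that disagreement down the [b]-paths and subtracting it restores [f] on
    level [N] at the cost of the values along these few paths. *)
Definition retarget N m v f y :=
  if (lev y <= N)%N then f y
  else extend m v y - push N (fun z => extend m v z - f z) y.

Lemma retarget_low N m v f y : (lev y <= N)%N -> retarget N m v f y = f y.
Proof. by rewrite /retarget => ->. Qed.

Lemma retarget_harmonic N m v f : harmonic f -> harmonic (retarget N m v f).
Proof.
move=> hf x; case: (ltnP (lev x) N) => [xN|Nx].
  rewrite /= retarget_low ?(ltnW xN)// hf !big_seq; apply: eq_bigr => y yx.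
  by rewrite retarget_low// (lev_child yx).
(* on level [N] itself both branches of [retarget] give [f x] *)
have -> : retarget N m v f x =
    extend m v x - push N (fun z => extend m v z - f z) x.
  rewrite /retarget; case: leqP => // xN.
  have /push_eq -> : lev x = N by apply/eqP; rewrite eqn_leq xN.
  by rewrite opprB addrC subrK.
rewrite extend_harmonic push_harmonic// -sumrB !big_seq.
apply: eq_bigr => y yx.
by rewrite /retarget (lev_child yx) leqNgt ltnS Nx/= scalerBr.
Qed.

Lemma retarget_hit N m v f (e : rays t) : (N <= m)%N -> ~ along N m e ->
  retarget N m v f (e m) = v (e m).
Proof.
move=> Nm off; rewrite /retarget lev_ray; case: leqP => [mN|Nltm].
  exfalso; apply: off => n /andP[Nn nm].
  by have := leq_trans nm (leq_trans mN Nn); rewrite ltnn.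
by rewrite (push_off _ Nm off) subr0 extend_eq// lev_ray.
Qed.

Section Sequence.
Context (g : nat -> T -> E) (target : nat -> nat -> T -> E).
Hypothesis g_harmonic : forall j, harmonic (g j).

(** The [j]-th function starts as [g j] and is retargeted between the levels
    [k ^ 2] and [(k + 1) ^ 2] at each step [k >= j].  Squares are used because
    the gap [2 * k + 1] between them tends to infinity, which makes the set of
    spoiled rays negligible as [k] grows. *)
Fixpoint stage j k : T -> E :=
  if k is k'.+1 then
    if (j <= k')%N then
      retarget (k' ^ 2) (k'.+1 ^ 2) (target k' j) (stage j k')
    else stage j k'
  else g j.

Lemma stage_harmonic j k : harmonic (stage j k).
Proof.
elim: k => [|k IHk] /=; first exact: g_harmonic.
by case: ifP => _ //; exact: retarget_harmonic.
Qed.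

Lemma stage_stable j k k' x : (k <= k')%N -> (lev x <= k ^ 2)%N ->
  stage j k' x = stage j k x.
Proof.
move=> /subnK <- xk; elim: (k' - k)%N => //= n <-; case: ifP => // _.
by rewrite retarget_low// (leq_trans xk)// leq_sqr leq_addl.
Qed.

Lemma stage_start j k : (k <= j)%N -> stage j k = g j.
Proof. by elim: k => //= k IHk kj; rewrite leqNgt kj/=; exact/IHk/ltnW. Qed.

Definition limit_stage j x := stage j (lev x) x.

Lemma limit_stageE j k x : (lev x <= k ^ 2)%N -> limit_stage j x = stage j k x.
Proof.
move=> xk; rewrite /limit_stage; have xx : (lev x <= lev x ^ 2)%N.
  by case: (lev x) => // n; rewrite leq_pmulr.
by case: (leqP (lev x) k) => [/stage_stable ->|/ltnW/stage_stable ->].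
Qed.

(** The exceptional set of rays depends neither on [j] nor on the targets, so that
    all the [f j] reach their targets simultaneously: this is what permits
    controlling their linear combinations. *)
Lemma interpolation : exists f : nat -> T -> E,
  [/\ forall j, harmonic (f j),
      forall j x, (lev x <= j ^ 2)%N -> f j x = g j x &
      forall j k e, (j <= k)%N -> ~ along (k ^ 2) (k.+1 ^ 2) e ->
        f j (e (k.+1 ^ 2)%N) = target k j (e (k.+1 ^ 2)%N)].
Proof.
exists limit_stage; split=> [j x|j x xj|j k e jk off].
- have le_sq : ((lev x).+1 <= (lev x).+1 ^ 2)%N by rewrite leq_pmulr.
  rewrite /= (@limit_stageE _ (lev x).+1) ?(leq_trans _ le_sq)//.
  rewrite stage_harmonic !big_seq; apply: eq_bigr => y yx.
  by rewrite (@limit_stageE _ (lev x).+1)// (lev_child yx).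
- by rewrite (limit_stageE _ xj) stage_start.
- rewrite (@limit_stageE _ k.+1) ?lev_ray//= jk retarget_hit//.
  by rewrite leq_sqr.
Qed.

End Sequence.

End HarmonicExtension.

(** * Measurable sets of rays and their approximation by levels *)

Section BoundaryLaw.
Context (R : realType) (T : choiceType) (t : rooted_tree T).
Context (q : T -> T -> R) (q_transition : transition t q).
Context (P : probability (boundary t) R) (P_law : boundary_law q P).

(** Two distinct children have transition probabilities of sum at most [1]. *)
Lemma light_child x : exists2 y, y \in children t x & q x y <= 2^-1.
Proof.
have := transition_sum q_transition x; have := fset_uniq (children t x).
have : (2 <= size (children t x))%N := children_ge2 t x.
have : {subset enum_fset (children t x) <= children t x} by [].
case: (enum_fset _) => [|y [|z s]]//= sub _ _; rewrite !big_cons => sum1.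
have : q x y + q x z <= 1.
  rewrite -sum1 addrA lerDl sumr_ge0// => u _.
  exact: transition_ge0 q_transition _ _.
case: (lerP (q x y) 2^-1) => [qy _|qy qyz].
  by exists y => //; apply: sub; rewrite inE eqxx.
exists z; first by apply: sub; rewrite !inE eqxx orbT.
by move: qy qyz; lra.
Qed.

Lemma prob_rays_through_child x y : y \in children t x ->
  P (rays_through y) = ((q x y)%:E * P (rays_through x))%E.
Proof.
move=> yx; have xl := lev_level t x; set n := lev t x in xl.
have [p [p0 pS pn]] := root_path xl.
rewrite (P_law xl p0 pS pn) (P_law (y := fun j => if (j <= n)%N then p j else y)
    (fsubsetP (children_level xl) _ yx)) //.
- rewrite big_ord_recr/= leqnn ltnn pn -EFinM mulrC; congr (_ * _)%:E.
  by apply: eq_bigr => i _; rewrite ltn_ord (ltnW (ltn_ord i)).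
- move=> j; rewrite ltnS => jn; rewrite jn; case: ltnP => [/pS//|nj].
  by have -> : j = n by [apply/eqP; rewrite eqn_leq jn]; rewrite pn.
- by rewrite ltnn.
Qed.

Lemma sum_prob_level n :
  (\sum_(x <- level t n) P (rays_through x) = 1)%E.
Proof.
rewrite -(probability_setT P) (_ : setT = \bigcup_(x in [set` level t n])
    (rays_through x : set (boundary t))).
  rewrite measure_fin_bigcup//.
  - by rewrite -fsbig_seq.
  - apply/trivIsetP => x y /= xn yn xy; rewrite -subset0 => e [ex ey].
    have xe : x = (e : rays t) n by apply/ray_levelP.
    by have /eqP := xy; rewrite xe; apply; apply/esym/ray_levelP.
  - by move=> x _; exact: measurable_rays_through.
apply/seteqP; split=> // e _; exists ((e : rays t) n); last by exists n.
exact: (ray_level (e : rays t) n).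
Qed.

(** Each further step along [b] at least halves the mass of every vertex
    of level [N], and these masses have sum [1]. *)
Lemma prob_along (b : T -> T) N k :
  (forall x, b x \in children t x) -> (forall x, q x (b x) <= 2^-1) ->
  exists B : set (boundary t),
    [/\ measurable B, (P B <= (2^-1 ^+ k)%:E)%E & along b N (N + k) `<=` B].
Proof.
move=> b_child b_light.
exists (\big[setU/set0]_(x <- level t N) (rays_through (iter k b x))); split.
- by apply: bigsetU_measurable => x _; exact: measurable_rays_through.
- rewrite -[leRHS]mule1 -(sum_prob_level N) ge0_sume_distrr//.
  elim: (enum_fset (level t N)) => [|x r IHr]; first by rewrite !big_nil measure0.
  rewrite !big_cons; apply: le_trans (measureU2 _ _ _) _.
  + exact: measurable_rays_through.
  + by apply: bigsetU_measurable => y _; exact: measurable_rays_through.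
  apply: leeD => //; elim: k {IHr} => [|k IHk] /=; first by rewrite mul1e.
  rewrite (prob_rays_through_child (b_child _)) exprS EFinM -muleA.
  by apply: lee_pmul => //; rewrite lee_fin// (transition_ge0 q_transition).
- move=> e eb; rewrite -bigcup_seq; exists ((e : rays t) N).
    exact: (ray_level (e : rays t) N).
  exists (N + k)%N; elim: k eb => [|k IHk] eb; first by rewrite addn0.
  rewrite addnS eb ?leq_addr ?addnS//= IHk// => n /andP[Nn nk].
  by apply: eb; rewrite Nn addnS ltnW.
Qed.

Lemma bigcup_tail (A : nat -> set (boundary t)) (eps : R) :
  (forall n, measurable (A n)) -> 0 < eps ->
  exists r, (P ((\bigcup_n A n) `\` \bigcup_(n < r) A n) < eps%:E)%E.
Proof.
move=> mA eps0; pose F r := (\bigcup_n A n) `\` \bigcup_(n < r) A n.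
have mF r : measurable (F r).
  by apply: measurableD; apply: bigcup_measurable.
have F0 : \bigcap_r F r = set0.
  rewrite -subset0 => e Fe; have [[n _ Ane] _] := Fe 0%N I.
  by have [_] := Fe n.+1 I; apply; exists n => /=.
have : P \o F @ \oo --> P (\bigcap_r F r).
  apply: nonincreasing_cvg_mu => //.
  - by rewrite (le_lt_trans (probability_le1 P _))// ltry.
  - by rewrite F0.
  - move=> r r' rr'; apply/subsetPset => e [Ae nAe]; split => // -[n /= nr An].
    by apply: nAe; exists n => //=; exact: leq_trans nr rr'.
rewrite F0 measure0 => /fine_cvgP[_ /cvgrPdist_lt/(_ _ eps0)].
move=> [r _ /(_ r (leqnn r))] /=; rewrite sub0r normrN => lt_eps; exists r.
rewrite -(fineK (fin_num_measure P _ (mF r))) lte_fin.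
exact: le_lt_trans (ler_norm _) lt_eps.
Qed.

(** Agreement off a measurable set of small probability, rather than convergence
    of a distance: the notion then makes sense for values in any type, and sets
    of rays are the case of values in [Prop]. *)
Definition level_approximable (Y : Type) (h : boundary t -> Y) :=
  forall eps : R, 0 < eps -> exists N (c : T -> Y) (B : set (boundary t)),
    [/\ measurable B, (P B < eps%:E)%E &
        forall e, ~ B e -> h e = c ((e : rays t) N)].

Lemma approximable_level Y (c : T -> Y) N :
  level_approximable (fun e => c ((e : rays t) N)).
Proof. by move=> eps eps0; exists N, c, set0; rewrite measure0 lte_fin. Qed.

Lemma probU_lt (A B : set (boundary t)) (eps : R) :
  measurable A -> measurable B -> (P A < (eps / 2)%:E)%E ->
  (P B < (eps / 2)%:E)%E -> (P (A `|` B) < eps%:E)%E.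
Proof.
move=> mA mB PA PB; apply: le_lt_trans (measureU2 _ mA mB) _.
by rewrite (splitr eps) EFinD lteD.
Qed.

Lemma approximable2 (Y1 Y2 Y : Type) (phi : Y1 -> Y2 -> Y) h1 h2 :
  level_approximable h1 -> level_approximable h2 ->
  level_approximable (fun e => phi (h1 e) (h2 e)).
Proof.
move=> ah1 ah2 eps eps0; have eps20 : 0 < eps / 2 by rewrite divr_gt0.
have [N1 [c1 [B1 [mB1 PB1 hc1]]]] := ah1 _ eps20.
have [N2 [c2 [B2 [mB2 PB2 hc2]]]] := ah2 _ eps20.
(* both functions are read off at the deeper level through ancestors *)
pose N := maxn N1 N2; exists N, (fun x => phi
  (c1 (iter (N - N1) (parent t) x)) (c2 (iter (N - N2) (parent t) x))), (B1 `|` B2).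
split; [exact: measurableU|exact: probU_lt|move=> e /not_orP[nB1 nB2]].
by rewrite hc1// hc2// !iter_parent_ray ?leq_maxl ?leq_maxr.
Qed.

Lemma approximable_limit (Y : Type) (h : boundary t -> Y) :
  (forall eps : R, 0 < eps -> exists h' B, [/\ level_approximable h',
     measurable B, (P B < eps%:E)%E & forall e, ~ B e -> h e = h' e]) ->
  level_approximable h.
Proof.
move=> ah eps eps0; have eps20 : 0 < eps / 2 by rewrite divr_gt0.
have [h' [B1 [/(_ _ eps20)[N [c [B2 [mB2 PB2 hc]]]] mB1 PB1 hh']]] := ah _ eps20.
exists N, c, (B1 `|` B2).
split; [exact: measurableU|exact: probU_lt|move=> e /not_orP[nB1 nB2]].
by rewrite hh'// hc.
Qed.

Lemma approximable_bigcup (A : nat -> set (boundary t)) r :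
  (forall n, level_approximable (A n)) ->
  level_approximable (\bigcup_(n < r) A n : set _).
Proof.
move=> aA; elim: r => [|r IHr].
  rewrite bigcup_mkord big_ord0; exact: (@approximable_level _ (fun=> False) 0).
by rewrite bigcup_mkord big_ord_recr/= -bigcup_mkord; exact: (approximable2 or).
Qed.

(** The measurable approximable sets form a sigma-algebra, because a countable
    union is a limit in probability of finite ones, and this sigma-algebra
    contains the events [rays_through x]. *)
Lemma approximable_measurable (A : set (boundary t)) :
  measurable A -> level_approximable A.
Proof.
pose G : set (set (boundary t)) :=
  [set A | measurable A /\ level_approximable A].
have sG : sigma_algebra setT G.
  split.
  - split; [exact: measurable0|exact: (@approximable_level _ (fun=> False) 0)].
  - move=> B [mB aB]; split; first exact: measurableD.
    exact: (approximable2 (fun X Y : Prop => X /\ ~ Y)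
      (@approximable_level _ (fun=> True) 0)).
  - move=> B GB; have mB n : measurable (B n) by have [] := GB n.
    split; first exact: bigcup_measurable.
    apply: approximable_limit => eps eps0; have [r Pr] := bigcup_tail mB eps0.
    exists (\bigcup_(n < r) B n), ((\bigcup_n B n) `\` \bigcup_(n < r) B n).
    split=> //.
    + by apply: approximable_bigcup => n; have [] := GB n.
    + by apply: measurableD; exact: bigcup_measurable.
    + move=> e nBe; apply/propext; split=> [Be|[n _ Bne]]; last by exists n.
      by apply: contrapT => nbe; exact: nBe.
suff: measurable `<=` G by move=> /(_ A)/[apply] -[].
apply: smallest_sub => // B [n _]; apply: smallest_sub => // _ [x /= xn <-].
split; first exact: measurable_rays_through.
rewrite (_ : rays_through x = fun e => x = (e : rays t) n).
  exact: (@approximable_level _ (fun y => x = y)).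
apply/funext => e; apply/propext; rewrite -ray_levelP.
by split=> [//|[]].
Qed.

(** Choosing on each ray an index of a set of a countable measurable cover,
    in such a way that the choice depends on one vertex of the ray.  Up to
    a small probability finitely many sets suffice, and the choice among finitely
    many measurable sets is a finite combination of their indicators. *)
Lemma level_selection (A : nat -> set (boundary t)) (eps : R) :
  (forall n, measurable (A n)) -> \bigcup_n A n = setT -> 0 < eps ->
  exists N (c : T -> nat) (B : set (boundary t)),
    [/\ measurable B, (P B < eps%:E)%E &
        forall e, ~ B e -> A (c ((e : rays t) N)) e].
Proof.
move=> mA AT eps0; have eps20 : 0 < eps / 2 by rewrite divr_gt0.
have [r Pr] := bigcup_tail mA eps20; rewrite AT setTD in Pr.
(* the index is the largest possible one below [k], with [0] as default *)
pose fix index (k : nat) (e : boundary t) {struct k} : nat :=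
  if k is k'.+1 then if `[< A k' e >] then k' else index k' e else 0%N.
have aindex k : level_approximable (index k).
  elim: k => [|k IHk]; first exact: (@approximable_level _ (fun=> 0%N) 0).
  exact: (approximable2 (fun (X : Prop) i => if `[< X >] then k else i)
    (approximable_measurable (mA k)) IHk).
have indexP k e n : (n < k)%N -> A n e -> A (index k e) e.
  elim: k => // k IHk; rewrite ltnS leq_eqVlt /=; case: asboolP => //= nAk.
  by move=> /predU1P[->//|]; exact: IHk.
have [N [c [B [mB PB cB]]]] := aindex r _ eps20.
have mU : measurable (~` \bigcup_(n < r) A n).
  by apply: measurableC; exact: bigcup_measurable.
exists N, c, (B `|` ~` \bigcup_(n < r) A n).
split; [exact: measurableU|exact: probU_lt|move=> e /not_orP[nB /contrapT[n nr An]]].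
by rewrite -cB//; exact: indexP An.
Qed.

End BoundaryLaw.

(** * Metrizable topological modules *)

Lemma dist_ge0 (R : realType) (E : zmodType) (d : invariant_metric R E)
  (x y : E) : 0 <= d x y.
Proof.
have : d x x <= d x y + d y x by exact: dist_triangle.
by rewrite distxx (dist_sym d y x); lra.
Qed.

Section MetricModule.
Context (R : realType) (F : fieldTopologicalType) (E : lmodType F).
Context (d : invariant_metric R E) (E_tvs : separable_tvs d).

Lemma dist_add (x y x' y' : E) : d (x + y) (x' + y') <= d x x' + d y y'.
Proof.
apply: le_trans (dist_triangle d (x' + y) _ _) _.
by rewrite dist_translation [x' + y]addrC [x' + y']addrC dist_translation.
Qed.

Lemma nbhs_distP (x : E) (A : set (metric_space d)) :
  nbhs (x : metric_space d) A <->
  exists2 eps : R, 0 < eps & forall y, d x y < eps -> A y.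
Proof.
rewrite -nbhs_ballE; split=> -[eps eps0 epsA]; exists eps => //.
Qed.

Lemma open_dist_ball (x : E) (eps : R) :
  open ([set y | d x y < eps] : set (metric_space d)).
Proof.
rewrite openE => y /= xy; apply/nbhs_distP; exists (eps - d x y).
  by rewrite subr_gt0.
move=> z yz; apply: le_lt_trans (dist_triangle d y _ _) _.
by rewrite -ltrBrDl.
Qed.

Lemma scale_continuous (a : F) (x : E) (eps : R) : 0 < eps ->
  exists2 delta, 0 < delta & forall y, d x y < delta -> d (a *: x) (a *: y) < eps.
Proof.
move=> eps0.
have : nbhs (a *: x : metric_space d) [set y | d (a *: x) y < eps].
  by apply/nbhs_distP; exists eps.
move=> /(@tvs_scale_continuous _ _ _ _ E_tvs (a, x : metric_space d)).
move=> [[A B] /= [Aa /nbhs_distP[delta delta0 dB]] AB].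
exists delta => // y xy; apply: (AB (a, y)); split => /=.
  exact: nbhs_singleton.
exact: dB.
Qed.

Lemma dense_sequence : exists p : nat -> E,
  forall x (eps : R), 0 < eps -> exists n, d x (p n) < eps.
Proof.
have [D cD dD] := tvs_separable E_tvs.
have meetD x eps : 0 < eps -> exists2 y : E, D y & d x y < eps.
  move=> eps0; have [||y [xy Dy]] := dD [set y | d x y < eps].
  - by exists x => /=; rewrite distxx.
  - exact: open_dist_ball.
  by exists y.
have [y0 Dy0 _] := meetD 0 1 ltr01.
have /pfcard_geP[D0|[p]] : (D #<= [set: nat])%card := cD.
  by rewrite D0 in Dy0.
exists (p : nat -> E) => x eps eps0; have [y Dy xy] := meetD x _ eps0.
by have [n _ pn] := @surj _ _ _ _ p _ Dy; exists n; rewrite pn.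
Qed.

(** Multiplication by a nonzero scalar is a homeomorphism. *)
Lemma dense_scale (p : nat -> E) (a : F) : a != 0 ->
  (forall x (eps : R), 0 < eps -> exists n, d x (p n) < eps) ->
  forall x (eps : R), 0 < eps -> exists n, d x (a *: p n) < eps.
Proof.
move=> a0 p_dense x eps eps0.
have [delta delta0 adelta] := scale_continuous a (a^-1 *: x) eps0.
have [n xn] := p_dense (a^-1 *: x) _ delta0.
by exists n; have := adelta _ xn; rewrite scalerA divff// scale1r.
Qed.

Section FunctionalContinuity.
Context (T : choiceType).

(** Continuity at [f] of a functional for the uniform distance over [S]. *)
Definition continuous_over (S : set T) (f : T -> E) (Phi : (T -> E) -> E) :=
  forall eps : R, 0 < eps -> exists2 delta, 0 < delta & forall v,
    (forall y, S y -> d (f y) (v y) < delta) -> d (Phi f) (Phi v) < eps.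

Lemma continuous_over_sum (S : set T) f (I : eqType) (s : seq I)
    (Phi : I -> (T -> E) -> E) :
  (forall i, i \in s -> continuous_over S f (Phi i)) ->
  continuous_over S f (fun v => \sum_(i <- s) Phi i v).
Proof.
elim: s => [|i s IHs] cPhi eps eps0.
  by exists 1 => // v _; rewrite !big_nil distxx.
have eps20 : 0 < eps / 2 by rewrite divr_gt0.
have [|d1 d10 Phi1] := cPhi i _ _ eps20; first by rewrite inE eqxx.
have [|d2 d20 Phi2] := IHs _ _ eps20.
  by move=> j js; apply: cPhi; rewrite inE js orbT.
exists (Num.min d1 d2) => [|v fv]; first by rewrite lt_min d10.
rewrite !big_cons; apply: le_lt_trans (dist_add _ _ _ _) _.
rewrite (splitr eps) ltrD ?Phi1 ?Phi2// => y /fv; rewrite lt_min => /andP[]//.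
Qed.

Lemma continuous_over_scale (S : set T) f (a : F) Phi :
  continuous_over S f Phi -> continuous_over S f (fun v => a *: Phi v).
Proof.
move=> cPhi eps /(scale_continuous a (Phi f))[delta /cPhi[delta' d'0 Phi'] ad].
by exists delta' => // v /Phi'; exact: ad.
Qed.

Lemma continuous_over_all (S : set T) f (I : eqType) (s : seq I)
    (Phi : I -> (T -> E) -> E) (eps : R) :
  (forall i, i \in s -> continuous_over S f (Phi i)) -> 0 < eps ->
  exists2 delta, 0 < delta & forall v,
    (forall y, S y -> d (f y) (v y) < delta) ->
    forall i, i \in s -> d (Phi i f) (Phi i v) < eps.
Proof.
move=> + eps0; elim: s => [|i s IHs] cPhi; first by exists 1.
have [|d1 d10 Phi1] := cPhi i _ _ eps0; first by rewrite inE eqxx.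
have [|d2 d20 Phi2] := IHs.
  by move=> j js; apply: cPhi; rewrite inE js orbT.
exists (Num.min d1 d2) => [|v fv j]; first by rewrite lt_min d10.
rewrite inE => /predU1P[->|js]; [apply: Phi1|apply: Phi2 => //];
  by move=> y /fv; rewrite lt_min => /andP[].
Qed.

End FunctionalContinuity.

End MetricModule.

(** * Convergence in probability *)

(** The integral of a nonnegative function is a supremum over the simple functions
    below it, hence monotone even where measurability is not known; this avoids
    proving that a distance between two measurable functions is measurable. *)
Lemma le_ge0_integral d (X : measurableType d) (R : realType)
    (mu : {measure set X -> \bar R}) (f g : X -> \bar R) :
  (forall x, 0 <= f x)%E -> (forall x, f x <= g x)%E ->
  (\int[mu]_x f x <= \int[mu]_x g x)%E.
Proof.
move=> f0 fg; have g0 x : (0 <= g x)%E by exact: le_trans (fg x).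
rewrite !ge0_integralTE//; apply: le_ereal_sup => _ [h hf <-].
by exists h => // x; exact: le_trans (fg x).
Qed.

Section ConvergenceInProbability.
Context (R : realType) (E : zmodType) (d : invariant_metric R E).
Context (T : choiceType) (t : rooted_tree T) (P : probability (boundary t) R).

(** The integrand of [L0_dist] is at most the distance, and at most [1]. *)
Lemma L0_dist_lt (h : L0 d P) (f : T -> E) n (B : set (boundary t)) (eps : R) :
  measurable B -> (P B < (eps / 2)%:E)%E -> 0 < eps ->
  (forall e, ~ B e -> d (h e) (f ((e : rays t) n)) < eps / 2) ->
  (L0_dist h (omega_class d P n f) < eps%:E)%E.
Proof.
move=> mB PB eps0 hf; set g := omega_class d P n f.
(* the representative of the class agrees with [omega d n f] off a null set *)
have : ae_eq_op P (repr g) (omega d n f) by apply/eqmodP; rewrite reprK.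
move=> /asboolP[N [mN PN gN]].
apply: le_lt_trans (le_ge0_integral (g := fun e =>
   ((cst (eps / 2)%:E) e + (\1_(B `|` N) e)%:E)%E) P _ _) _.
- by move=> e; rewrite lee_fin divr_ge0 ?addr_ge0 ?dist_ge0.
- move=> e; set r := d (h e) (g e); have r0 : 0 <= r by exact: dist_ge0.
  have r1 : 0 < 1 + r by lra.
  rewrite /= indicE; case: (pselect ((B `|` N) e)) => eBN.
    rewrite mem_set// -EFinD lee_fin ler_pdivrMr//.
    have := mulr_ge0 (ltW eps0) r0; rewrite /=; lra.
  rewrite memNset// adde0 lee_fin ler_pdivrMr//.
  move/not_orP : eBN => [/hf re nN].
  have ge : (g : boundary t -> E) e = f ((e : rays t) n).
    by apply: contrapT => gf; apply: nN; apply: gN => /= /(_ I).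
  by have := mulr_ge0 (ltW eps0) r0; rewrite {}/r ge in r0 r1 *; lra.
rewrite ge0_integralD//=.
- rewrite integral_cst//= [P _]probability_setT mule1 integral_indic//=; last first.
    exact: measurableU.
  rewrite setIT [X in (_ < X%:E)%E](splitr eps) EFinD lteD2lE//.
  apply: le_lt_trans (measureU2 _ mB mN) _.
  by rewrite [X in (_ + X)%E]PN adde0.
- by move=> e _; rewrite lee_fin divr_ge0// ltW.
- by apply/measurable_EFinP; apply: measurable_indic; exact: measurableU.
Qed.

Lemma dense_L0 (S : set (L0 d P)) :
  (forall h (eps : R), 0 < eps -> exists2 g, S g & (L0_dist h g < eps%:E)%E) ->
  dense S.
Proof.
move=> Sd O [h Oh] oO; have [eps eps0 hO] := oO h Oh.
by have [g Sg hg] := Sd h eps eps0; exists g; split => //; exact: hO.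
Qed.

End ConvergenceInProbability.

(** * Coded targets and universality *)

(** The exponent of [2] takes every value at arbitrarily large integers. *)
Lemma recurrent_enumeration (A : countType) (a0 : A) : exists u : nat -> A,
  forall a K, exists2 k, (K <= k)%N & u k = a.
Proof.
exists (fun k => odflt a0 (choice.unpickle (logn 2 k))) => a K.
exists (2 ^ choice.pickle a * K.*2.+1)%N.
  by rewrite (leq_trans _ (leq_pmull _ _)) ?expn_gt0// -addnn leqW// leq_addr.
rewrite lognM ?expn_gt0// pfactorK// lognE/= dvdn2 /= odd_double/= addn0.
by rewrite choice.pickleK.
Qed.

Section CodedTargets.
Context (R : realType) (F : fieldTopologicalType) (E : lmodType F).
Context (d : invariant_metric R E) (E_tvs : separable_tvs d).
Context (T : choiceType) (t : rooted_tree T) (w : T -> T -> F).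

(** A list of integers codes the function on level [N] whose values are the
    corresponding terms of [p]; the point is that there are countably many codes. *)
Definition decode (Y : Type) (p : nat -> Y) N (s : seq nat) (x : T) : Y :=
  p (nth 0%N s (index x (level t N))).

Lemma decode_surj (Y : Type) (p : nat -> Y) N (c : T -> nat) :
  exists s, forall x, x \in level t N -> decode p N s x = p (c x).
Proof.
exists (map c (level t N)) => x xN; rewrite /decode (nth_map x) ?index_mem//.
by rewrite nth_index.
Qed.

Lemma harmonic_average (f : T -> E) k x : harmonic_functions t w f ->
  average t w f k x = f x.
Proof.
move=> hf; elim: k x => //= k IHk x.
by rewrite hf; apply: eq_bigr => y _; rewrite IHk.
Qed.

Lemma average_continuous (f : T -> E) N k x : (lev t x + k = N)%N ->
  continuous_over d [set` level t N] f (fun v => average t w v k x).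
Proof.
elim: k x => [|k IHk] x xN /=.
  move=> eps eps0; exists eps => // v; apply => /=.
  by rewrite -xN addn0 lev_level.
apply: continuous_over_sum => y yx; apply: continuous_over_scale => //.
by apply: IHk; rewrite (lev_child yx) addSnnS.
Qed.

(** A harmonic function is determined on the levels up to [N] by its values on
    level [N], through finite linear combinations, which are continuous.  It is
    therefore enough to approximate these values by terms of [p]. *)
Lemma harmonic_approximation (b : T -> T) (p : nat -> E) (f : T -> E) N eps :
  (forall x (eps : R), 0 < eps -> exists n, d x (p n) < eps) ->
  harmonic_functions t w f -> 0 < eps ->
  exists s, forall x, (lev t x <= N)%N ->
    d (f x) (extend t w b N (decode p N s) x) < eps.
Proof.
move=> p_dense hf eps0.
pose vertices := [seq x | n <- iota 0 N.+1, x <- level t n].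
have verticesP x : (lev t x <= N)%N -> x \in vertices.
  move=> xN; apply/allpairsPdep; exists (lev t x), x.
  by split; rewrite ?lev_level// mem_iota.
have [|delta delta0 close] := @continuous_over_all _ _ _ d _
    [set` level t N] f _ vertices
    (fun x v => average t w v (N - lev t x) x) eps _ eps0.
  move=> x /allpairsPdep[n [y [+ yn ->]]]; rewrite mem_iota/= => nN.
  by apply: average_continuous; rewrite (level_lev yn) subnKC.
have [c fc] := choice (fun y => p_dense (f y) _ delta0).
have [s sc] := decode_surj p N c; exists s => x xN.
have := close (decode p N s) _ x (verticesP _ xN).
rewrite harmonic_average// /extend xN; apply => y yN.
by rewrite sc.
Qed.

Context (P : probability (boundary t) R).
Context (b : T -> T).
Hypothesis b_prob : forall N k, exists B : set (boundary t),
  [/\ measurable B, (P B <= (2^-1 ^+ k)%:E)%E & along b N (N + k) `<=` B].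
Context (p : nat -> E).
Hypothesis p_dense : forall x (eps : R), 0 < eps -> exists n, d x (p n) < eps.
Context (task : nat -> nat * (nat * seq nat)).
Hypothesis task_recurrent : forall a K, exists2 k, (K <= k)%N & task k = a.
Context (f : nat -> T -> E).

(** Letting the other functions vanish isolates the term of index [i] of any
    linear combination. *)
Definition task_target k (j : nat) y : E :=
  let: (i, (N, s)) := task k in
  if j == i then decode p N s (iter (k.+1 ^ 2 - N) (parent t) y) else 0.

Hypothesis f_hit : forall j k (e : rays t), (j <= k)%N ->
  ~ along b (k ^ 2) (k.+1 ^ 2) e ->
  f j (e (k.+1 ^ 2)%N) = task_target k j (e (k.+1 ^ 2)%N).

(** At a step whose task concerns [i], the combination equals [a i] times the coded
    function off a small set, since the other terms vanish there.  Coded functions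
    with values in the sequence [a i *: p m], which is again dense, come
    arbitrarily close to [h] in probability. *)
Lemma combination_dense n (a : nat -> F) i : (i < n)%N -> a i != 0 ->
  dense (range (fun m => omega_class d P m
    (fun x => \sum_(j < n) a j *: f j x))).
Proof.
move=> i_n ai0; apply: dense_L0 => h eps eps0.
have eps20 : 0 < eps / 2 by rewrite divr_gt0.
have eps40 : 0 < eps / 2 / 2 by rewrite divr_gt0.
pose A m : set (boundary t) := [set e | d (h e) (a i *: p m) < eps / 2].
have mA m : measurable (A m).
  rewrite (_ : A m = (h : boundary t -> borel d) @^-1`
    [set y | d (a i *: p m) y < eps / 2]); last first.
    by apply/seteqP; split=> e; rewrite /A /= dist_sym.
  have /measurable_fun_borelP := measurable_funPT (repr h).
  apply; exact: open_dist_ball.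
have AT : \bigcup_m A m = setT.
  apply/seteqP; split=> // e _.
  by have [m hm] := dense_scale E_tvs ai0 p_dense (h e) eps20; exists m.
have [N [c [B [mB PB hB]]]] := level_selection P mA AT eps40.
have [s sc] := decode_surj p N c.
have [K PK] : exists K, forall k, (K <= k)%N -> 2^-1 ^+ k < eps / 2 / 2.
  have : (fun k => 2^-1 ^+ k : R) @ \oo --> 0.
    by apply: cvg_expr; rewrite ger0_norm ?invr_ge0// invf_lt1// ltr1n.
  move=> /cvgrPdist_lt/(_ _ eps40)[K _ PK]; exists K => // k /PK.
  by rewrite /= sub0r normrN ger0_norm// exprn_ge0// invr_ge0.
(* [K <= k] makes the probability small, [n <= k] makes the other terms vanish,
   and [N <= k] puts level [N] above the level reached *)
have [k + task_k] := task_recurrent (i, (N, s)) (maxn K (maxn n N)).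
rewrite !geq_max => /and3P[Kk nk Nk].
have sqS : (k.+1 ^ 2 = k ^ 2 + k.*2.+1)%N by rewrite -addn1 sqrnD; lia.
have [B' [mB' PB' alongB']] := b_prob (k ^ 2) k.*2.+1; rewrite -sqS in alongB'.
exists (omega_class d P (k.+1 ^ 2) (fun x => \sum_(j < n) a j *: f j x)).
  by exists (k.+1 ^ 2)%N.
apply: (@L0_dist_lt _ _ _ _ _ _ _ _ _ (B `|` B')) => //.
- exact: measurableU.
- apply: probU_lt => //; apply: le_lt_trans PB' _; rewrite lte_fin PK//.
  by apply: leq_trans Kk _; lia.
move=> e /not_orP[nB nB']; have Nk2 : (N <= k.+1 ^ 2)%N.
  by apply: leq_trans Nk _; rewrite sqS; lia.
have -> : \sum_(j < n) a j *: f j ((e : rays t) (k.+1 ^ 2)%N) =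
    a i *: p (c ((e : rays t) N)).
  rewrite (bigD1 (Ordinal i_n))//= big1 ?addr0 => [|j ji]; last first.
    rewrite f_hit ?(leq_trans (ltnW (ltn_ord j)))//; last by move/alongB'.
    rewrite /task_target task_k ifN ?scaler0//.
  rewrite f_hit ?(leq_trans (ltnW i_n))//; last by move/alongB'.
  by rewrite /task_target task_k eqxx iter_parent_ray// sc// ray_level.
exact: hB.
Qed.

End CodedTargets.

(** * The space of finite combinations *)

Section FiniteCombinations.
Context (T : Type) (F : fieldType) (E : lmodType F) (f : nat -> T -> E).

Definition combinations : set (T -> E) :=
  [set u | exists n (a : nat -> F), u = fun x => \sum_(j < n) a j *: f j x].

Lemma combinations_submod : submod_closed [in combinations].
Proof.
have widen n m (a : nat -> F) x : (n <= m)%N -> \sum_(j < n) a j *: f j x =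
    \sum_(j < m) (if (j < n)%N then a j else 0) *: f j x.
  move=> nm; rewrite (big_ord_widen m (fun j => a j *: f j x) nm) big_mkcond/=.
  by apply: eq_bigr => j _; case: ifP; rewrite ?scale0r.
split.
  rewrite inE; exists 0%N, (fun=> 0); apply/funext => x; by rewrite big_ord0.
move=> c u v; rewrite !inE => -[n [a ->]] [m [a' ->]].
exists (maxn n m), (fun j => c * (if (j < n)%N then a j else 0) +
                             if (j < m)%N then a' j else 0).
apply/funext => x /=; transitivity (c *: (\sum_(j < n) a j *: f j x) +
                             \sum_(j < m) a' j *: f j x) => //.
rewrite (widen _ _ _ _ (leq_maxl n m)) (widen _ _ _ _ (leq_maxr n m)).
rewrite scaler_sumr -big_split; apply: eq_bigr => j _ /=.
by rewrite scalerA scalerDl.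
Qed.

Lemma combinations_mem j : combinations (f j).
Proof.
exists j.+1, (fun i => (i == j)%:R); apply/funext => x.
rewrite (bigD1 ord_max)//= eqxx scale1r big1 ?addr0// => i ij.
by rewrite (_ : (i == j :> nat) = false) ?scale0r//; apply: contraNF ij.
Qed.

End FiniteCombinations.

Theorem theorem2 (R : realType)
    (F : fieldTopologicalType) (hF : admissible_scalars F)
    (E : lmodType F) (d : invariant_metric R E) (hE : separable_tvs d)
    (T : choiceType) (t : rooted_tree T)
    (w : T -> T -> F) (hw : forall x y, y \in children t x -> w x y != 0)
    (q : T -> T -> R) (hq : transition t q)
    (P : probability (boundary t) R) (hP : boundary_law q P) :
  exists V : set (T -> E),
    [/\ submod_closed [in V],
        V `<=` harmonic_functions t w,
        V `<=` universal d w P `|` [set 0] &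
        harmonic_functions t w `<=` closure (V : set {ptws T -> metric_space d})].
Proof.
have [b b_child b_light] : exists2 b : T -> T,
    forall x, b x \in children t x & forall x, q x (b x) <= 2^-1.
  have /choice[b bP] : forall x, exists y, y \in children t x /\ q x y <= 2^-1.
    by move=> x; have [y] := light_child hq x; exists y.
  by exists b => x; have [] := bP x.
have [p p_dense] := dense_sequence hE.
have [task task_recurrent] := recurrent_enumeration (0%N, (0%N, [::] : seq nat)).
have [start start_recurrent] := recurrent_enumeration (0%N, [::] : seq nat).
pose g j := extend t w b (start j).1 (decode t p (start j).1 (start j).2).
have [f [f_harmonic f_start f_hit]] :=
  interpolation hw b_child (task_target t p task)
    (fun j => extend_harmonic hw b_child (start j).1 _ :
       harmonic_functions t w (g j)).
have comb_harmonic : combinations f `<=` harmonic_functions t w.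
  move=> _ [n [a ->]] x; under eq_bigr do rewrite f_harmonic scaler_sumr.
  rewrite exchange_big; apply: eq_bigr => y _ /=; rewrite scaler_sumr.
  by apply: eq_bigr => j _; rewrite !scalerA mulrC.
exists (combinations f); split=> //.
- exact: combinations_submod.
- move=> u Vu; have [n [a uE]] := Vu.
  have [/existsP[i ai0]|] := boolP [exists i : 'I_n, a i != 0].
    left; split; first exact: comb_harmonic.
    rewrite uE; apply: (combination_dense hE _ p_dense task_recurrent f_hit
      (ltn_ord i) ai0).
    by move=> N k; exact: (prob_along hq hP).
  rewrite negb_exists => /forallP a0; right; rewrite uE; apply/funext => x.
  by rewrite big1// => i _; have /negPn/eqP -> := a0 i; rewrite scale0r.
move=> h h_harmonic.
(* a starting function approximates [h] up to level [N], and it recurs at an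
   index [j] large enough for [f j] to keep it up to that level *)
have close N : exists j, forall x, (lev t x <= N)%N -> d (h x) (f j x) < N.+1%:R^-1.
  have [|s hs] := harmonic_approximation hE b N p_dense h_harmonic
    (eps := N.+1%:R^-1).
    by rewrite invr_gt0.
  have [j Nj startj] := start_recurrent (N, s) N.
  exists j => x xN; rewrite f_start; first by rewrite /g startj; exact: hs.
  by apply: leq_trans xN (leq_trans Nj _); case: (j) => // m; rewrite leq_pmulr.
have [j hj] := choice close.
have cvg_h : {ptws, (fun N => f (j N)) @ \oo --> (h : T -> metric_space d)}.
  apply/cvg_sup => x U [_ [[W oW <-] /= Wh /filterS]]; apply.
  have /nbhs_distP[eps eps0 epsW] : nbhs (h x : metric_space d) W.
    exact: open_nbhs_nbhs.
  near_simpl; near=> N; apply: epsW; apply: (@lt_trans _ _ N.+1%:R^-1).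
    by apply: hj; near: N; exact: nbhs_infty_ge.
  near: N; exact: (near_infty_natSinv_lt (PosNum eps0)).
move=> B /cvg_h[N _ BN]; exists (f (j N)); split; first exact: combinations_mem.
exact: BN N (leqnn N).
Unshelve. all: by end_near.
Qed.
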